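(* Let $k$ be a field, $R=k[x_1,\dots,x_n]$, and let $I\subseteq R$ be the edge ideal of a graph $\mathcal H$ on the vertex set $V=\{1,\dots,n\}$. Then $\operatorname{depth} R/I^2>0$ if and only if $\mathcal H$ has no dominating triangle.
   Context: A graph on $V$ is a collection of 2-element subsets of $V$ (edges). The edge ideal of $\mathcal H$ is the ideal of $R$ generated by all $x_ix_j$ with $\{i,j\}\in\mathcal H$. Depth is taken with respect to the maximal homogeneous ideal $(x_1,\dots,x_n)$. A set $U\subseteq V$ is dominating if every vertex of $V$ is adjacent to at least one vertex of $U$. A triangle of $\mathcal H$ is dominating if the set of its three vertices is dominating. *)

(* Defs.v *)
From HB Require Import structures.
From mathcomp Require Import all_boot all_order all_algebra.
From mathcomp Require Import generic_quotient ring_quotient.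
(* mpoly has to come before the classical files: the opposite order is a
   notation-level conflict. *)
From mathcomp Require Import mpoly.
From mathcomp Require Import boolp classical_sets constructive_ereal.

Set Implicit Arguments.
Unset Strict Implicit.
Unset Printing Implicit Defensive.

Import GRing.Theory.
Local Open Scope classical_set_scope.
Local Open Scope ring_scope.
Local Open Scope quotient_scope.

(* Ideals of R are the submodules of the regular module R^o. *)
Section Ideals.
Variable R : comNzRingType.

Definition ideal_gen (G : set R) : {pred R^o} := fun p =>
  `[< exists (m : nat) (a g : 'I_m -> R),
        (forall i, G (g i)) /\ p = \sum_(i < m) a i * g i >].

Lemma ideal_gen_submod_closed (G : set R) : submod_closed (ideal_gen G).
Proof.
split=> [|a p q /asboolP[m [b [g [Gg ->]]]] /asboolP[m' [b' [g' [Gg' ->]]]]].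
  apply/asboolP; exists 0%N, (fun=> 0), (fun=> 0).
  by split=> [[]|]; rewrite ?big_ord0.
apply/asboolP; exists (m + m')%N,
  (fun i => match split i with inl j => a * b j | inr j => b' j end),
  (fun i => match split i with inl j => g j | inr j => g' j end).
split=> [i|]; first by case: (split i).
rewrite big_split_ord /= scaler_sumr; congr (_ + _); apply: eq_bigr => i _.
  by rewrite (unsplitK (inl i)); exact: mulrA.
by rewrite (unsplitK (inr i)).
Qed.

HB.instance Definition _ (G : set R) :=
  GRing.isSubmodClosed.Build R R^o (ideal_gen G) (ideal_gen_submod_closed G).

Definition ideal_mul (I J : {pred R^o}) : {pred R^o} :=
  ideal_gen [set p | exists f g : R, [/\ f \in I, g \in J & p = f * g]].

HB.instance Definition _ (I J : {pred R^o}) :=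
  GRing.SubmodClosed.on (ideal_mul I J).

End Ideals.

Section QuotientModule.
Variables (R : comNzRingType) (M : lmodType R) (N : submodClosed M).

(* The library's submodClosed only provides closure under addition and scaling,
   whereas Quotient.quot also requires closure under opposite. *)
Definition submod_pred : {pred M} := N.

Lemma submod_pred_submod_closed : submod_closed submod_pred.
Proof. exact: submodClosedP. Qed.

HB.instance Definition _ :=
  GRing.isSubmodClosed.Build R M submod_pred submod_pred_submod_closed.

Definition quot_mod : Type := Quotient.quot submod_pred.

HB.instance Definition _ := GRing.Zmodule.on quot_mod.
HB.instance Definition _ := ZmodQuotient.on quot_mod.

Definition quot_scale (a : R) (x : quot_mod) : quot_mod :=
  \pi_quot_mod (a *: repr x).

Lemma pi_scale (a : R) (x : M) :
  quot_scale a (\pi_quot_mod x) = \pi_quot_mod (a *: x).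
Proof.
apply/eqP; rewrite /quot_scale -Quotient.idealrBE -scalerBr rpredZ //.
by rewrite Quotient.idealrBE reprK.
Qed.

Let scaleA a b x : quot_scale a (quot_scale b x) = quot_scale (a * b) x.
Proof. by rewrite -[x]reprK !pi_scale scalerA reprK. Qed.

Let scale1 : left_id 1 quot_scale.
Proof. by move=> x; rewrite -[x]reprK pi_scale scale1r. Qed.

Let scaleDr : right_distributive quot_scale +%R.
Proof.
move=> a x y; rewrite -[x]reprK -[y]reprK -raddfD !pi_scale -raddfD.
by rewrite -scalerDr.
Qed.

Let scaleDl x : {morph quot_scale^~ x : a b / a + b}.
Proof. by move=> a b; rewrite -[x]reprK !pi_scale -raddfD -scalerDl. Qed.

HB.instance Definition _ := GRing.Zmodule_isLmodule.Build R quot_mod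
  scaleA scale1 scaleDr scaleDl.

End QuotientModule.

Section Depth.
Variables (R : comNzRingType) (M : lmodType R).

(* (s_0, ..., s_(r-1)) M *)
Definition seq_smul (s : seq R) : set M :=
  [set y | exists u : 'I_(size s) -> M, y = \sum_(i < size s) s`_i *: u i].

(* s_i is a nonzerodivisor on M / (s_0, ..., s_(i-1)) M for every i, and
   M / (s) M is not 0. *)
Definition regular_seq (s : seq R) : Prop :=
  (forall i, (i < size s)%N -> forall x : M,
     seq_smul (take i s) (s`_i *: x) -> seq_smul (take i s) x)
  /\ seq_smul s <> setT.

(* Taken in \bar int so that the supremum always exists; the default 0 is
   reached only if not even the empty sequence is regular, i.e. if M = 0. *)
Definition depth (I : {pred R^o}) : \bar int :=
  supremum 0%E
    [set d | exists s : seq R,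
       [/\ {subset s <= I}, regular_seq s & d = ((size s)%:Z%:E)%E]].

End Depth.

Section Graphs.
Variable n : nat.

Definition is_graph (H : {set {set 'I_n}}) : Prop :=
  forall e, e \in H -> #|e| = 2%N.

(* If H is a graph, adjacent vertices are distinct, since [set i; i] has
   cardinality 1; so i is not adjacent to itself. *)
Definition adjacent (H : {set {set 'I_n}}) (i j : 'I_n) : bool :=
  [set i; j]%SET \in H.

Definition dominating (H : {set {set 'I_n}}) (U : {set 'I_n}) : Prop :=
  forall v : 'I_n, exists2 u, u \in U & adjacent H v u.

Definition is_triangle (H : {set {set 'I_n}}) (T : {set 'I_n}) : Prop :=
  #|T| = 3%N /\
  (forall i j, i \in T -> j \in T -> i != j -> adjacent H i j).

End Graphs.

Section EdgeIdeal.
Variables (k : fieldType) (n : nat).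

Definition edge_ideal (H : {set {set 'I_n}}) : {pred {mpoly k[n]}^o} :=
  ideal_gen [set p : {mpoly k[n]} |
    exists i j : 'I_n, adjacent H i j /\ p = 'X_i * 'X_j].

Definition max_homog_ideal : {pred {mpoly k[n]}^o} :=
  ideal_gen [set p : {mpoly k[n]} | exists i : 'I_n, p = 'X_i].

End EdgeIdeal.

Arguments edge_ideal k {n} H _ : rename.
Arguments max_homog_ideal k n _ : clear implicits, rename.

(* Main.v *)
(* Positive depth means that the maximal homogeneous ideal contains a
   nonzerodivisor on [R/I^2].  The ideal [I^2] is monomial, and for a monomial
   ideal the form [x_1 + ... + x_n] is a nonzerodivisor as soon as no monomial
   outside the ideal is sent into it by every variable.  (This choice works over
   finite fields too, where a generic linear form need not exist.)

   If [u] is such a monomial for [I^2], then every vertex is adjacent to the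
   support of [u], the support contains no two disjoint edges, and [u] is
   squarefree, since a square in [u] would split off two edges at a common
   vertex.  Every vertex of the support thus has two neighbours in the support,
   so the support spans a triangle, and it is dominating.  Conversely, if
   [{a, b, c}] is a dominating triangle, then [x_a x_b x_c] is not in [I^2] for
   degree reasons, but [x_v x_a x_b x_c] is: if [v] is adjacent to [a], it is
   the product of the edges [va] and [bc]. *)

Require Import Defs.
From HB Require Import structures.
From mathcomp Require Import all_boot all_order all_algebra.
From mathcomp Require Import generic_quotient ring_quotient.
From mathcomp Require Import mpoly.
From mathcomp Require Import boolp classical_sets constructive_ereal.
From mathcomp Require Import zify.

Set Implicit Arguments.
Unset Strict Implicit.
Unset Printing Implicit Defensive.

Import Order.TTheory GRing.Theory Num.Theory.

Local Open Scope ring_scope.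

(** * Suprema of sets of lengths in the extended integers *)

(** A bounded nonempty set of naturals contains its least upper bound, and an unbounded one has
    supremum [+oo]. *)
Lemma nat_ereal_supremums (A : set nat) : (A !=set0)%classic ->
  (supremums [set m%:Z%:E%E | m in A] !=set0)%classic.
Proof.
move=> [a Aa]; have [[b bA]|unbounded] := pselect (exists b, ubound A b).
  have [c [cA leA]] := nat_supremums_neq0 (ex_intro _ b bA).
  exists (c%:Z%:E)%E; split=> [_ [m Am <-]|y yA].
    by rewrite lee_fin lez_nat; exact: cA.
  suff Ac : A c by apply: yA; exists c.
  apply: contrapT => nAc.
  have c_gt0 : (0 < c)%N.
    rewrite lt0n; apply/negP=> /eqP c0; apply: nAc.
    by have := cA _ Aa; rewrite c0 leEnat leqn0 => /eqP <-.
  (* A least bound [c] outside [A] could be lowered by one. *)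
  have : ubound A c.-1.
    move=> m Am; have := cA _ Am; rewrite !leEnat.
    suff : m <> c by lia.
    by move=> mc; apply: nAc; rewrite -mc.
  by move/leA; rewrite leEnat; lia.
exists +oo%E; split=> [_ [m Am <-]|[z| |] yA]; rewrite ?leey //.
  have [] := unbounded; exists `|z|%N => m Am.
  have /yA : [set m%:Z%:E%E | m in A]%classic m%:Z%:E%E by exists m.
  by rewrite lee_fin leEnat; lia.
have /yA : [set m%:Z%:E%E | m in A]%classic a%:Z%:E%E by exists a.
by [].
Qed.

Lemma mem_ideal_gen (R : comNzRingType) (G : set R) (g : R) :
  G g -> g \in (ideal_gen G : {pred R^o}).
Proof.
move=> Gg; apply/asboolP; exists 1%N, (fun=> 1), (fun=> g).
by rewrite big_ord1 mul1r.
Qed.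

(** * Positive depth and nonzerodivisors *)

Section DepthPositive.
Variables (R : comNzRingType) (M : lmodType R).

Lemma seq_smul0 (x : M) : seq_smul [::] x <-> x = 0.
Proof.
split=> [[u ->]|->]; first by rewrite big_ord0.
by exists (fun=> 0); rewrite big_ord0.
Qed.

Lemma seq_smul1 (f : R) (x : M) : seq_smul [:: f] x <-> exists y, x = f *: y.
Proof.
split=> [[u ->]|[y ->]]; first by exists (u ord0); rewrite big_ord1.
by exists (fun=> y); rewrite big_ord1.
Qed.

Lemma regular_seq_head (f : R) (s : seq R) : regular_seq M (f :: s) ->
  forall x : M, f *: x = 0 -> x = 0.
Proof.
move=> [reg _] x fx0; apply/seq_smul0/(reg 0%N) => //=.
exact/seq_smul0.
Qed.

Lemma regular_seq1 (f : R) :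
  (forall x : M, f *: x = 0 -> x = 0) -> (exists x : M, forall y, x <> f *: y) ->
  regular_seq M [:: f].
Proof.
move=> nzd [x nx]; split=> [[|//] _ y /seq_smul0 fy|]; first exact/seq_smul0/nzd.
move=> fT; have : [set: M]%classic x by [].
by rewrite -fT => /seq_smul1[y]; exact: nx.
Qed.

(** Without such an [f], only the empty sequence can be regular, so [0] bounds all lengths; the
    default of [supremum] is [0] too. *)
Lemma depth_gt0 (I : {pred R^o}) : (0 < depth M I)%E ->
  exists2 f : R, f \in I & forall x : M, f *: x = 0 -> x = 0.
Proof.
move=> dpos; apply: contrapT => noreg; move: dpos; apply/negP.
rewrite -leNgt /depth /supremum; case: ifP => [//|_].
case: xgetP => [d _ [_ /(_ 0%E) leA]|//]; apply: leA => _ [[|f s] [sI reg ->]] //.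
case: noreg; exists f; first by apply: sI; rewrite mem_head.
exact: regular_seq_head reg.
Qed.

(** The length 1 occurs, and [nat_ereal_supremums] ensures that [depth] is a true supremum rather
    than the default. *)
Lemma regular_depth_gt0 (I : {pred R^o}) (f : R) : f \in I ->
  regular_seq M [:: f] -> (0 < depth M I)%E.
Proof.
move=> fI reg; apply: (@lt_le_trans _ _ 1%:E%E) => //.
apply: ge_supremum_Nmem; last by exists [:: f]; split=> // x /[!inE] /eqP->.
pose A := [set m | exists s : seq R,
  [/\ {subset s <= I}, regular_seq M s & m = size s]]%classic.
suff -> : [set d | exists s : seq R,
    [/\ {subset s <= I}, regular_seq M s & d = (size s)%:Z%:E%E]]%classic
  = [set m%:Z%:E%E | m in A]%classic.
  apply: nat_ereal_supremums; exists 1%N, [:: f].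
  by split=> // x /[!inE] /eqP->.
apply/seteqP; split=> [_ [s [sI rs ->]]|_ [_ [s [sI rs ->]] <-]].
  by exists (size s) => //; exists s.
by exists s.
Qed.

End DepthPositive.

Section QuotientFacts.
Variables (R : comNzRingType) (M : lmodType R) (N : submodClosed M).

Lemma quot_mod_eqP (x y : M) :
  (\pi_(quot_mod N) x)%qT = (\pi_(quot_mod N) y)%qT <-> x - y \in N.
Proof.
have -> : (x - y \in N) = (x - y \in submod_pred N) by [].
by rewrite Quotient.idealrBE; split=> [/eqP|/eqP].
Qed.

Lemma quot_mod_eq0P (x : M) : (\pi_(quot_mod N) x)%qT = 0 <-> x \in N.
Proof.
rewrite -[x in x \in _]subr0 -quot_mod_eqP.
by rewrite (raddf0 (\pi_(quot_mod N))%qT).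
Qed.

Lemma scale_quot_mod (a : R) (x : M) :
  a *: (\pi_(quot_mod N) x)%qT = (\pi_(quot_mod N) (a *: x))%qT.
Proof. exact: pi_scale. Qed.

End QuotientFacts.

(** * Monomials outside [I^2] that every variable sends into [I^2] *)

Section SocleMonomials.
Variables (n : nat) (H : {set {set 'I_n}}).

Lemma adjacentC (i j : 'I_n) : adjacent H i j = adjacent H j i.
Proof. by rewrite /adjacent finset.setUC. Qed.

Lemma adjacent_neq (i j : 'I_n) : is_graph H -> adjacent H i j -> i <> j.
Proof. by move=> hH /hH + ij; rewrite ij finset.setUid cards1. Qed.

(** These are the exponents of the monomials in [I^2]; the two edges may coincide or share a vertex,
    counted with multiplicity. *)
Definition two_edges (m : 'X_{1..n}) : Prop :=
  exists i j k l, [/\ adjacent H i j, adjacent H k l &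
    (U_(i) + U_(j) + (U_(k) + U_(l)) <= m)%MM].

Lemma edges_lepP (i j k l : 'I_n) (m : 'X_{1..n}) :
  reflect (forall x, (i == x) + (j == x) + ((k == x) + (l == x)) <= m x)%N
    (U_(i) + U_(j) + (U_(k) + U_(l)) <= m)%MM.
Proof.
by apply: (iffP mnm_lepP) => le x; have := le x; rewrite !mnmDE !mnm1E.
Qed.

Lemma two_edgesDl (m m' : 'X_{1..n}) : two_edges m -> two_edges (m' + m)%MM.
Proof.
move=> [i [j [k [l [ij kl le]]]]]; exists i, j, k, l; split=> //.
exact: lepm_trans le (lem_addl _ _).
Qed.

Lemma mdeg_two_edges (m : 'X_{1..n}) : two_edges m -> (4 <= mdeg m)%N.
Proof.
move=> [i [j [k [l [_ _ le]]]]].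
by rewrite -(submK le) !mdegD !mdeg1 leq_addl.
Qed.

Variable m : 'X_{1..n}.
Hypotheses (hH : is_graph H) (m_out : ~ two_edges m).

(** The four vertices are distinct, so the product of the two edges is squarefree and divides the
    monomial. *)
Lemma disjoint_edgesF (a b c d : 'I_n) : adjacent H a b -> adjacent H c d ->
  (0 < m a)%N -> (0 < m b)%N -> (0 < m c)%N -> (0 < m d)%N ->
  a <> c -> a <> d -> b <> c -> b <> d -> False.
Proof.
move=> ab cd ma mb mc md ac ad bc bd; apply: m_out; exists a, b, c, d.
have nab := adjacent_neq hH ab; have ncd := adjacent_neq hH cd.
split=> //; apply/edges_lepP => x.
case: (a =P x) => ?; case: (b =P x) => ?; case: (c =P x) => ?;
  case: (d =P x) => ?; subst; first [congruence | lia].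
Qed.

Hypothesis m_soc : forall v, two_edges (m + U_(v))%MM.

(** One endpoint of the two edges dividing [m + U_(v)] is [v], as otherwise they would divide [m];
    cancelling it leaves its neighbour [j] and the other edge. *)
Lemma socle_nbr (v : 'I_n) : exists j k l, [/\ adjacent H v j, adjacent H k l &
  forall x, ((j == x) + ((k == x) + (l == x)) <= m x)%N].
Proof.
have [i [j [k [l [ij kl /edges_lepP le]]]]] := m_soc v.
have {}le x : ((i == x) + (j == x) + ((k == x) + (l == x)) <= m x + (v == x))%N.
  by have := le x; rewrite mnmDE mnm1E.
have [vi|nvi] := eqVneq i v.
  by exists j, k, l; rewrite -vi; split=> // x; have := le x; rewrite vi; lia.
have [vj|nvj] := eqVneq j v.
  exists i, k, l; rewrite -vj adjacentC; split=> // x.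
  by have := le x; rewrite vj; lia.
have [vk|nvk] := eqVneq k v.
  by exists l, i, j; rewrite -vk; split=> // x; have := le x; rewrite vk; lia.
have [vl|nvl] := eqVneq l v.
  exists k, i, j; rewrite -vl adjacentC; split=> // x.
  by have := le x; rewrite vl; lia.
case: m_out; exists i, j, k, l; split=> //; apply/edges_lepP => x.
have [<-|nvx] := eqVneq v x.
  by rewrite (negbTE nvi) (negbTE nvj) (negbTE nvk) (negbTE nvl).
by have := le x; rewrite (negbTE nvx) addn0.
Qed.

(* A repeated factor [x_l] would split [x_l^2 x_j x_p] into the edges [lj], [lp]. *)
Lemma socle_supp (l : 'I_n) : (0 < m l)%N -> m l = 1%N /\
  exists j p, [/\ adjacent H l j, adjacent H l p &
    forall x, ((j == x) + ((p == x) + (l == x)) <= m x)%N].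
Proof.
move=> ml; have [j [p [q [lj pq le]]]] := socle_nbr l.
(* The edge [pq] contains [l]: otherwise [lj] and [pq] together would divide [m]. *)
have [p' [lp' le']] : exists p', adjacent H l p' /\
    forall x, ((j == x) + ((p' == x) + (l == x)) <= m x)%N.
  have [qE|nql] := eqVneq q l.
    by exists p; rewrite -qE adjacentC; split=> // x; exact: le.
  have [pE|npl] := eqVneq p l.
    by exists q; rewrite -pE; split=> // x; rewrite (addnC (q == x)); exact: le.
  case: m_out; exists l, j, p, q; split=> //; apply/edges_lepP => x.
  have [<-|nlx] := eqVneq l x; last by have := le x; lia.
  have njl : (j == l) = false by apply/eqP => /esym; exact: adjacent_neq.
  by rewrite (negbTE nql) (negbTE npl) njl.
split; last by exists j, p'.
apply/eqP; rewrite eqn_leq ml andbT leqNgt; apply/negP=> ml2.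
apply: m_out; exists l, j, l, p'; split=> //; apply/edges_lepP => x.
have [lx|nlx] := eqVneq l x; last by have := le' x; lia.
have nj : (j == x) = false.
  by apply/eqP; rewrite -lx => /esym; exact: adjacent_neq.
have np : (p' == x) = false.
  by apply/eqP; rewrite -lx => /esym; exact: adjacent_neq.
by rewrite nj np -lx.
Qed.

(** If the two neighbours from [socle_supp] coincided, [m] would have a repeated factor. *)
Lemma socle_two_nbrs (l : 'I_n) : (0 < m l)%N -> exists j p,
  [/\ adjacent H l j, adjacent H l p, (0 < m j)%N, (0 < m p)%N & j <> p].
Proof.
move=> /socle_supp[_ [j [p [lj lp le]]]].
have mj : (0 < m j)%N by have := le j; rewrite eqxx; lia.
have mp : (0 < m p)%N by have := le p; rewrite eqxx; lia.
exists j, p; split=> // jp; subst p.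
by have := le j; rewrite eqxx (socle_supp mj).1; lia.
Qed.

Lemma socle_other_nbr (l k : 'I_n) : (0 < m l)%N -> exists j,
  [/\ adjacent H l j, (0 < m j)%N & j <> k].
Proof.
move=> /socle_two_nbrs[j [p [lj lp mj mp jp]]].
by have [jk|/eqP jk] := eqVneq j k; [exists p | exists j]; split=> //; congruence.
Qed.

Lemma socle_dominating_triangle : (0 < n)%N ->
  exists T : {set 'I_n}, is_triangle H T /\ dominating H T.
Proof.
move=> n0; have [a [k [l [_ _ le]]]] := socle_nbr (Ordinal n0).
have ma : (0 < m a)%N by have := le a; rewrite eqxx; lia.
have [b [c [ab ac mb mc bc]]] := socle_two_nbrs ma.
have nab := adjacent_neq hH ab; have nac := adjacent_neq hH ac.
(* If [b] had a neighbour [d] in the support other than [a] and [c], the edges [bd] and [ac] would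
   be disjoint. *)
have bcE : adjacent H b c.
  have [d [bd md da]] := socle_other_nbr a mb.
  have [dc|/eqP dc] := eqVneq d c; first by rewrite -dc.
  have nbd := adjacent_neq hH bd.
  by case: (disjoint_edgesF bd ac) => //; congruence.
exists [set a; b; c]%SET; split; first split.
- rewrite -finset.setUA cardsU1 cards2 !inE.
  by move/eqP/negbTE: nab => ->; move/eqP/negbTE: nac => ->; move/eqP: bc => ->.
- move=> i j; rewrite !inE => /orP[/orP[]|] /eqP-> /orP[/orP[]|] /eqP->;
  by rewrite ?eqxx // adjacentC.
- move=> v; have [j [p [q [vj _ le']]]] := socle_nbr v.
  have mj : (0 < m j)%N by have := le' j; rewrite eqxx; lia.
  exists j => //; apply: contrapT => /negP; rewrite !inE !negb_or -andbA.
  move=> /and3P[/eqP ja /eqP jb /eqP jc].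
  (* For [j] outside the triangle, the edge [jd] avoids [ac] when [d = b], and avoids [ab]
     otherwise. *)
  have [d [jd md da]] := socle_other_nbr a mj.
  have [db|/eqP db] := eqVneq d b.
    by case: (disjoint_edgesF jd ac) => //; congruence.
  by case: (disjoint_edgesF jd ab) => //; congruence.
Qed.

End SocleMonomials.

(** * Monomial ideals through supports of polynomials *)

Section MonomialIdeals.
Variables (k : fieldType) (n : nat).
Implicit Types (P : 'X_{1..n} -> Prop) (p q : {mpoly k[n]}).

Definition msupp_in P p := forall m, m \in msupp p -> P m.

Lemma msupp_inM P Q S p q : (forall m1 m2, P m1 -> Q m2 -> S (m1 + m2)%MM) ->
  msupp_in P p -> msupp_in Q q -> msupp_in S (p * q).
Proof.
move=> PQS Pp Qq m /msuppM_le/allpairsP[[m1 m2] /= [/Pp P1 /Qq Q2 ->]].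
exact: PQS.
Qed.

Lemma ideal_gen_msupp_in P (G : set {mpoly k[n]}) p :
  (forall m m', P m -> P (m' + m)%MM) -> (forall g, G g -> msupp_in P g) ->
  p \in ideal_gen G -> msupp_in P p.
Proof.
move=> Pup GP /asboolP[r [a [g [Gg ->]]]] m /msupp_sum_le/flatten_mapP[i _].
apply: (@msupp_inM (fun=> True) P P) => //; last exact: GP.
by move=> m1 m2 _; exact: Pup.
Qed.

Variable H : {set {set 'I_n}}.
Local Notation I := (edge_ideal k H).

Lemma edge_ideal_msupp p : p \in I -> msupp_in
  (fun m => exists i j, adjacent H i j /\ (U_(i) + U_(j) <= m)%MM) p.
Proof.
apply: ideal_gen_msupp_in => [m m' [i [j [ij le]]]|_ [i [j [ij ->]]] m].
  by exists i, j; split=> //; exact: lepm_trans le (lem_addl _ _).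
by rewrite -mpolyXD => /mem_msuppXP <-; exists i, j; split; last exact: lepm_refl.
Qed.

Lemma edge_ideal_sqP p : p \in ideal_mul I I <-> msupp_in (two_edges H) p.
Proof.
split.
  apply: ideal_gen_msupp_in => [|_ [f [g
      [/edge_ideal_msupp fI /edge_ideal_msupp gI ->]]]].
    exact: two_edgesDl.
  apply: msupp_inM fI gI => m1 m2 [i [j [ij le]]] [i' [j' [ij' le']]].
  exists i, j, i', j'; split=> //; apply/mnm_lepP=> x.
  by move/mnm_lepP: le => /(_ x); move/mnm_lepP: le' => /(_ x); rewrite !mnmDE; lia.
move=> pI; rewrite [p]mpolyE big_seq; apply: rpred_sum => m /pI.
move=> [i [j [a [b [ij ab le]]]]].
rewrite -(submK le) !mpolyXD scalerAl.
apply: (@rpredZ _ {mpoly k[n]}^o (ideal_mul I I)).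
apply: mem_ideal_gen; exists ('X_i * 'X_j), ('X_a * 'X_b); split=> //.
  by apply: mem_ideal_gen; exists i, j.
by apply: mem_ideal_gen; exists a, b.
Qed.

Lemma max_homog_ideal_coef0 p : p \in max_homog_ideal k n -> p@_0%MM = 0.
Proof.
move=> pm; apply: memN_msupp_eq0; apply/negP=> p0.
suff : msupp_in (fun m => (0 < mdeg m)%N) p by move/(_ _ p0); rewrite mdeg0.
apply: ideal_gen_msupp_in pm => [m m'|_ [i ->] m]; first by rewrite mdegD; lia.
by move/mem_msuppXP <-; rewrite mdeg1.
Qed.

(** Both summands have zero constant term. This keeps the quotient by [f] nonzero, as regularity
    demands. *)
Lemma one_notin_max_sum f p q : f \in max_homog_ideal k n ->
  p \in ideal_mul I I -> 1 <> f * q + p.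
Proof.
move=> /max_homog_ideal_coef0 f0 /edge_ideal_sqP pI /(congr1 (mcoeff 0%MM)).
rewrite mcoeffD rmorphM /= f0 mul0r add0r mcoeff1 eqxx => /eqP.
rewrite eq_sym (memN_msupp_eq0 (m := 0%MM)) ?(eq_sym 0) ?oner_eq0 //.
by apply/negP=> /pI /mdeg_two_edges; rewrite mdeg0.
Qed.

(** Induction on the number of terms of [p] outside [P]. If every variable sends [p] into [P], any
    such term will do; otherwise some [p * 'X_i] is again a counterexample, with fewer such
    terms. *)
Lemma sum_var_zerodivisor_socle P p :
  (forall m m', P m -> P (m' + m)%MM) ->
  msupp_in P ((\sum_(j < n) 'X_j) * p) -> ~ msupp_in P p ->
  exists m, ~ P m /\ forall v, P (m + U_(v))%MM.
Proof.
move=> Pup; pose out q := [seq m <- msupp q | ~~ `[< P m >]].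
have [N] := ubnP (size (out p)); elim: N p => // N IH p outN fp pout.
have [soc|] := pselect (forall i, msupp_in P (p * 'X_i)).
  have [m mp nPm] : exists2 m, m \in msupp p & ~ P m.
    apply: contrapT => noex; apply: pout => m mp; apply: contrapT => nPm.
    by apply: noex; exists m.
  exists m; split=> // v; rewrite addmC; apply: (soc v).
  by rewrite (perm_mem (msuppMX _ _)) map_f.
move=> /existsNP[i pi_out]; apply: (IH (p * 'X_i)) => //; last first.
  rewrite mulrA; apply: (@msupp_inM P (fun=> True) P) fp _ => // m1 m2 P1 _.
  by rewrite addmC; exact: Pup.
have [u u_out umax] : exists2 u, u \in out p &
    forall m, m \in out p -> (m i <= u i)%N.
  have exd : exists d, has (fun m : 'X_{1..n} => m i == d) (out p).
    have [m m_out] : exists m, m \in out p.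
      apply: contrapT => noex; apply: pout => m mp; apply: contrapT => nPm.
      by apply: noex; exists m; rewrite mem_filter mp andbT; apply/asboolPn.
    by exists (m i); apply/hasP; exists m.
  have bd d : has (fun m : 'X_{1..n} => m i == d) (out p) ->
      (d <= \max_(m <- out p) m i)%N.
    by case/hasP => m m_out /eqP <-;
      exact: (@leq_bigmax_seq _ _ xpredT (fun m : 'X_{1..n} => m i)).
  case: (ex_maxnP exd bd) => d /hasP[u u_out /eqP ud] dmax.
  by exists u => // m m_out; rewrite ud; apply: dmax; apply/hasP; exists m.
move: (u_out); rewrite mem_filter => /andP[/asboolPn nPu up].
(* At a term of maximal [x_i]-degree outside [P], no other product contributes to
   the coefficient of [x_i u] in [(\sum_j x_j) p]. *)
have Pui : P (U_(i) + u)%MM.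
  apply: contrapT => nPui; apply/nPui/fp.
  rewrite mcoeff_msupp mulr_suml raddf_sum /= (bigD1 i) //= big1 => [|j ji].
    by rewrite addr0 mulrC mcoeffMX -mcoeff_msupp.
  apply: memN_msupp_eq0; rewrite mulrC (perm_mem (msuppMX _ _)).
  apply/mapP => -[m mp mE].
  have m_out : m \in out p.
    rewrite mem_filter mp andbT; apply/asboolPn => Pm; apply: nPui.
    by rewrite mE; exact: Pup.
  (* Such an [m] would have [x_i]-degree one more than [u]. *)
  have := umax m m_out; move/(congr1 (fun m : 'X_{1..n} => m i)): mE.
  by rewrite !mnmDE !mnm1E eqxx (negbTE ji); lia.
have out_uniq q : uniq (out q) by rewrite filter_uniq // msupp_uniq.
suff : (size (out (p * 'X_i)%R) < size (out p))%N.
  by move=> lt; rewrite -ltnS; exact: leq_trans lt _.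
have out_pi m : m \in out (p * 'X_i) ->
    exists2 m', m' \in out p & m = (U_(i) + m')%MM /\ m' <> u.
  rewrite mem_filter (perm_mem (msuppMX _ _)) => /andP[/asboolPn nPm].
  case/mapP => m' m'p mE; subst m; exists m'.
    rewrite mem_filter m'p andbT; apply/asboolPn => Pm'; apply: nPm; exact: Pup.
  by split=> // m'u; apply: nPm; rewrite m'u.
(* Shifting by [U_(i)] embeds the outside terms of [p * 'X_i] in those of [p], and the shift of [u]
   is missed. *)
rewrite -(size_map (fun m => U_(i) + m)%MM (out p)).
apply: (@uniq_leq_size _ ((U_(i) + u)%MM :: out (p * 'X_i))).
  rewrite /= out_uniq andbT; apply/negP => /out_pi[m' _ [/esym + m'u]].
  by rewrite ![(U_(i) + _)%MM]addmC => /addIm.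
move=> m; rewrite inE => /predU1P[->|/out_pi[m' m'_out [-> _]]]; exact: map_f.
Qed.

Lemma edge_ideal_sq_sum_var p : (0 < n)%N -> is_graph H ->
  ~ (exists T : {set 'I_n}, is_triangle H T /\ dominating H T) ->
  (\sum_(j < n) 'X_j) * p \in ideal_mul I I -> p \in ideal_mul I I.
Proof.
move=> n0 hH noT /edge_ideal_sqP fp; apply: contrapT => /edge_ideal_sqP pI.
have [|m [m_out m_soc]] := sum_var_zerodivisor_socle _ fp pI.
  exact: two_edgesDl.
by apply: noT; exact: (@socle_dominating_triangle n H m).
Qed.

Lemma dominating_triangle_socle (T : {set 'I_n}) :
  is_triangle H T -> dominating H T -> exists2 u : {mpoly k[n]},
    u \notin ideal_mul I I &
    forall f, f \in max_homog_ideal k n -> f * u \in ideal_mul I I.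
Proof.
move=> [T3 Tadj] Tdom; exists 'X_[\sum_(i in T) U_(i)].
  apply/negP => /edge_ideal_sqP /(_ (\sum_(i in T) U_(i))%MM).
  rewrite msuppX mem_head => /(_ isT) /mdeg_two_edges.
  rewrite mdeg_sum (eq_bigr (fun=> 1%N)) => [|i _].
    by rewrite sum1_card T3.
  exact: mdeg1.
move=> f; rewrite mulrC => /asboolP[r [a [g [Gg ->]]]].
rewrite mulr_sumr; apply: rpred_sum => s _; have [v ->] := Gg s.
rewrite mulrCA; apply: (@rpredZ _ {mpoly k[n]}^o (ideal_mul I I)).
(* The product splits into the edge [vt] and the side [bc] of the triangle opposite [t]. *)
have [t tT vt] := Tdom v.
have /cards2P[b [c [bc TE]]] : #|(T :\ t)%SET| == 2%N.
  by move: T3; rewrite (cardsD1 t) tT => -[] /eqP.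
rewrite -mpolyXD; apply/edge_ideal_sqP => m /mem_msuppXP <-.
have /setD1P[_ bT] : b \in (T :\ t)%SET by rewrite TE !inE eqxx.
have /setD1P[_ cT] : c \in (T :\ t)%SET by rewrite TE !inE eqxx orbT.
exists v, t, b, c; split=> //; first exact: Tadj.
rewrite (finset.big_setD1 t) //= TE finset.big_setU1 ?inE // finset.big_set1.
by rewrite [X in (_ <= X)%MM]addmC -addmA; exact: lepm_refl.
Qed.

End MonomialIdeals.

Theorem theorem2p8 (k : fieldType) (n : nat) (hn : (0 < n)%N)
    (H : {set {set 'I_n}}) (hH : is_graph H) :
  (0 < depth (quot_mod (ideal_mul (edge_ideal k H) (edge_ideal k H)))
         (max_homog_ideal k n))%E
  <-> ~ (exists T : {set 'I_n}, is_triangle H T /\ dominating H T).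
Proof.
split=> [/depth_gt0[f fm nzd] [T [tri dom]]|noT].
  (* The class of [u] is nonzero but killed by [f]. *)
  have [u /negP u_out u_soc] := dominating_triangle_socle k tri dom.
  apply/u_out/quot_mod_eq0P/nzd.
  rewrite scale_quot_mod; apply/quot_mod_eq0P; exact: u_soc.
have fm : \sum_(j < n) 'X_j \in max_homog_ideal k n.
  by apply: rpred_sum => j _; apply: mem_ideal_gen; exists j.
apply: (regular_depth_gt0 fm); apply: regular_seq1 => [x|].
  rewrite -[x]reprK scale_quot_mod => /quot_mod_eq0P fx.
  apply/quot_mod_eq0P; exact: edge_ideal_sq_sum_var fx.
(* The class of 1 is not a multiple of the sum of the variables. *)
exists (\pi 1)%qT => y; rewrite -[y]reprK scale_quot_mod => /quot_mod_eqP oneI.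
apply: (one_notin_max_sum (q := repr y) fm oneI).
by rewrite addrC subrK.
Qed.
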